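(* Let $(K,\partial)$ be an algebraically closed differential field of characteristic $0$, let $X$ be an irreducible (affine) algebraic variety over $K$, and let $\partial'$ be a derivation of the function field $K(X)$ extending $\partial$ (so $(X,\partial')$ is a rational $D$-variety over $(K,\partial)$). Let $\Omega(X)=\Omega_K(X)$ be the $K(X)$-vector space of rational differential $1$-forms on $X$ over $K$. Then: (i) For $f\in K(X)$, setting $D^{1}(df)=d(\partial'(f))$ gives a well-defined additive map from $\{df : f\in K(X)\}\subseteq \Omega(X)$ to $\Omega(X)$ (in particular, if $f_1,f_2\in K(X)$ and $df_1=df_2$, then $d(\partial'(f_1))=d(\partial'(f_2))$). (ii) The map in (i) extends uniquely to a map $D^{1}:\Omega(X)\to\Omega(X)$ giving $\Omega(X)$ the structure of a $\partial'$-module over $K(X)$.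
   Context: Rational $D$-variety: a rational $D$-variety structure over $(K,\partial)$ on an irreducible algebraic variety $X$ over $K$ is an extension $\partial'$ of the derivation $\partial$ of $K$ to a derivation of the function field $K(X)$. Rational differential forms: $\Omega(X)=\Omega_K(X)$ is the collection of objects $\omega=\sum_{i=1}^{m} f_i\,dg_i$ with $f_i,g_i\in K(X)$. For $X\subseteq K^n$ with coordinates $x_1,\dots,x_n$, and $\alpha\in X(K)$ at which all $f_i,g_i$ are defined, $\omega_\alpha=\sum_i f_i(\alpha)(dg_i)_\alpha$ is an element of the cotangent space $T(X)_\alpha^{*}$, where $(dg)_\alpha$ is the linear form $\sum_{j=1}^{n}(\partial g/\partial x_j)(\alpha)u_j$ on the tangent space $T(X)_\alpha$. Two such forms $\omega_1,\omega_2$ are considered equal if $(\omega_1)_\alpha=(\omega_2)_\alpha$ for all $\alpha$ in a nonempty Zariski open subset of $X(K)$. Equivalently, $\Omega_K(X)$ is the $K(X)$-vector space $\Omega(K(X)/K)$ of Kähler differentials of $K(X)$ over $K$, with universal $K$-derivation $d:K(X)\to\Omega(K(X)/K)$. $\partial$-modules: given a field $L$ with a derivation $\delta$, a $\delta$-module over $L$ is an $L$-vector space $V$ equipped with an additive endomorphism $D_V:V\to V$ such that $D_V(c\cdot v)=c\cdot D_V(v)+\delta(c)\cdot v$ for all $c\in L$ and $v\in V$. In the claim this is applied with $L=K(X)$ and $\delta=\partial'$. *)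

(* Defs.v *)
From HB Require Import structures.
From mathcomp Require Import all_boot all_algebra.
From mathcomp Require Import boolp.
From mathcomp Require Import mpoly.
From mathcomp Require Import ring.

Set Implicit Arguments.
Unset Strict Implicit.
Unset Printing Implicit Defensive.

Import GRing.Theory.
Local Open Scope ring_scope.
Local Open Scope quotient_scope.

Notation "p ^`M ( i )" := (mderiv i p).

Definition is_derivation (R : nzRingType) (delta : R -> R) : Prop :=
  (forall x y, delta (x + y) = delta x + delta y) /\
  (forall x y, delta (x * y) = x * delta y + delta x * y).

Definition is_delta_module (L : fieldType) (delta : L -> L) (V : lmodType L)
    (D : V -> V) : Prop :=
  (forall v w, D (v + w) = D v + D w) /\
  (forall c v, D (c *: v) = c *: D v + delta c *: v).

Lemma subf_div (F : fieldType) (x y x' y' : F) : y != 0 -> y' != 0 ->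
  x / y - x' / y' = (x * y' - x' * y) / (y * y').
Proof. by move=> y0 y0'; rewrite -mulNr addf_div // mulNr. Qed.

Section Varieties.
Variables (K : fieldType) (n : nat).
Local Notation poly := {mpoly K[n]}.
Local Notation pt := 'rV[K]_n.
Implicit Types (p q : poly) (a u : pt) (A B U : pt -> Prop).

Definition ev p a : K := p.@[a ord0].

Definition zariski_closed A : Prop :=
  exists S : poly -> Prop, forall a, A a <-> (forall p, S p -> ev p a = 0).

Definition zariski_open U : Prop := zariski_closed (fun a => ~ U a).

Record affine_variety := AffineVariety {
  points :> pt -> Prop;
  points_closed : zariski_closed points;
  points_nonempty : exists a, points a;
  points_irreducible : forall A B, zariski_closed A -> zariski_closed B ->
    (forall a, points a -> A a \/ B a) ->
    (forall a, points a -> A a) \/ (forall a, points a -> B a)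
}.

End Varieties.

Section FunctionField.
Variables (K : fieldType) (n : nat) (X : affine_variety K n).
Local Notation poly := {mpoly K[n]}.
Local Notation pt := 'rV[K]_n.

Definition vanishing_ideal : {pred poly} :=
  fun p => `[< forall a, X a -> ev p a = 0 >].

Lemma vanishingP p :
  reflect (forall a, X a -> ev p a = 0) (p \in vanishing_ideal).
Proof. exact: asboolP. Qed.

Lemma closed_zero_locus (p : poly) : zariski_closed (fun a => ev p a = 0).
Proof. by exists (eq p) => a; split=> [pa0 _ <-|h]; [|exact: h]. Qed.

Lemma vanishing_idealr_closed : idealr_closed vanishing_ideal.
Proof.
split=> [||p q r /vanishingP q0 /vanishingP r0].
- by apply/vanishingP => a _; rewrite /ev meval0.
- apply/negP => /vanishingP h; have [a Xa] := points_nonempty X.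
  by have /eqP := h a Xa; rewrite /ev meval1 oner_eq0.
- apply/vanishingP => a Xa; have := q0 a Xa; have := r0 a Xa.
  by rewrite /ev mevalD mevalM => -> ->; rewrite mulr0 addr0.
Qed.

Lemma vanishing_prime : prime_idealr_closed vanishing_ideal.
Proof.
move=> p q /vanishingP pq0.
have := points_irreducible (closed_zero_locus p) (closed_zero_locus q).
move=> /(_ X)[a Xa|h|h].
- have /eqP := pq0 a Xa.
  by rewrite /ev mevalM mulf_eq0 => /orP[]/eqP; [left|right].
- by apply/orP; left; apply/vanishingP.
- by apply/orP; right; apply/vanishingP.
Qed.

HB.instance Definition _ :=
  isIdealr.Build poly vanishing_ideal vanishing_idealr_closed.
HB.instance Definition _ :=
  isPrimeIdealrClosed.Build poly vanishing_ideal vanishing_prime.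

Definition coord_ring := {ideal_quot vanishing_ideal}.

HB.instance Definition _ := GRing.ComNzRing.on coord_ring.

Definition poly_coord (p : poly) : coord_ring := \pi_coord_ring p.

Lemma poly_coord_is_zmod_morphism : zmod_morphism poly_coord.
Proof. by move=> p q; rewrite /poly_coord !piE. Qed.

Lemma poly_coord_is_monoid_morphism : monoid_morphism poly_coord.
Proof. by rewrite /poly_coord; split=> [|p q]; rewrite !piE. Qed.

HB.instance Definition _ :=
  GRing.isZmodMorphism.Build poly coord_ring poly_coord
    poly_coord_is_zmod_morphism.
HB.instance Definition _ :=
  GRing.isMonoidMorphism.Build poly coord_ring poly_coord
    poly_coord_is_monoid_morphism.

(* A quotient by a prime ideal has no integral domain instance in the library:
   the inverse on units is obtained by choice. *)
Definition coord_unit : {pred coord_ring} := fun x => `[< exists y, y * x = 1 >].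

Definition coord_inv (x : coord_ring) : coord_ring :=
  if pselect (exists y, y * x = 1) is left h then projT1 (cid h) else x.

Lemma coord_mulVx : {in coord_unit, left_inverse 1 coord_inv *%R}.
Proof.
move=> x /asboolP h; rewrite /coord_inv; case: pselect => // h'.
by case: cid.
Qed.

Lemma coord_unitPl x y : y * x = 1 -> coord_unit x.
Proof. by move=> yx; apply/asboolP; exists y. Qed.

Lemma coord_invr_out : {in [predC coord_unit], coord_inv =1 id}.
Proof.
move=> x; rewrite inE => /negP nu; rewrite /coord_inv; case: pselect => // h.
by case: nu; apply/asboolP.
Qed.

HB.instance Definition _ := GRing.ComNzRing_hasMulInverse.Build coord_ring
  coord_mulVx coord_unitPl coord_invr_out.

HB.instance Definition _ := GRing.ComUnitRing_isIntegral.Build coord_ring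
  (@Quotient.rquot_IdomainAxiom _ vanishing_ideal).

Definition function_field := {fraction coord_ring}.

(* The field operations are those of {fraction coord_ring}, but the boolean
   equality and the choice operator are the classical ones: unfolding the
   structural ones makes conversion tests on rational functions diverge. *)
HB.instance Definition _ := gen_eqMixin function_field.
HB.instance Definition _ := gen_choiceMixin function_field.
HB.instance Definition _ := GRing.isZmodule.Build function_field
  (@addrA {fraction coord_ring}) (@addrC {fraction coord_ring})
  (@add0r {fraction coord_ring}) (@addNr {fraction coord_ring}).

Lemma function_field_oner_neq0 : ((1 : {fraction coord_ring}) : function_field) != 0.
Proof. by apply/eqP => e; have /eqP := oner_neq0 {fraction coord_ring}. Qed.

HB.instance Definition _ := GRing.Zmodule_isComNzRing.Build function_field
  (@mulrA {fraction coord_ring}) (@mulrC {fraction coord_ring})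
  (@mul1r {fraction coord_ring}) (@mulrDl {fraction coord_ring})
  function_field_oner_neq0.

Lemma function_field_mulVf (f : function_field) :
  f != 0 -> (f : {fraction coord_ring})^-1 * (f : {fraction coord_ring}) = 1.
Proof. by move=> /eqP f0; apply: mulVf; apply/eqP. Qed.

HB.instance Definition _ := GRing.ComNzRing_isField.Build function_field
  function_field_mulVf (invr0 {fraction coord_ring}).

End FunctionField.

HB.lock Definition polyF (K : fieldType) (n : nat) (X : affine_variety K n)
    (p : {mpoly K[n]}) : function_field X :=
  FracField.tofrac (poly_coord X p).

Section RationalFunctions.
Variables (K : fieldType) (n : nat) (X : affine_variety K n).
Local Notation poly := {mpoly K[n]}.
Local Notation pt := 'rV[K]_n.
Local Notation vanishing_ideal := (vanishing_ideal X).
Local Notation function_field := (function_field X).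
Local Notation polyF := (@polyF K n X).

Lemma polyF_is_zmod_morphism : zmod_morphism polyF.
Proof. by move=> p q; rewrite !polyF.unlock !rmorphB. Qed.

Lemma polyF_is_monoid_morphism : monoid_morphism polyF.
Proof. by split=> [|p q]; rewrite !polyF.unlock ?rmorph1 ?rmorphM ?rmorph1 ?rmorphM. Qed.

HB.instance Definition _ :=
  GRing.isZmodMorphism.Build poly function_field polyF polyF_is_zmod_morphism.
HB.instance Definition _ :=
  GRing.isMonoidMorphism.Build poly function_field polyF
    polyF_is_monoid_morphism.

Definition scalarF (c : K) : function_field := polyF c%:MP.

Lemma polyF_eq0 p : (polyF p == 0) = (p \in vanishing_ideal).
Proof.
rewrite -[p in RHS]subr0 Quotient.idealrBE -[LHS]/(_ == _) polyF.unlock.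
rewrite -(tofrac_eq (poly_coord X p) (poly_coord X 0)).
by apply/eqP/eqP => ->; rewrite ?rmorph0.
Qed.

Lemma polyF_eq0P p : reflect (forall a, X a -> ev p a = 0) (polyF p == 0).
Proof. by rewrite polyF_eq0; apply: vanishingP. Qed.

Lemma polyF_neq0 p a : X a -> ev p a != 0 -> polyF p != 0.
Proof. by move=> Xa pa; apply/polyF_eq0P => /(_ a Xa)/eqP; apply/negP. Qed.

Lemma fractionP (R : idomainType) (f : {fraction R}) :
  exists x y : R, y != 0 /\ f = FracField.tofrac x / FracField.tofrac y.
Proof.
elim/quotW: f => -[[x y] /= y0]; exists x, y; split=> //.
apply: (canRL (mulfK _)); first by rewrite tofrac_eq0.
unlock FracField.tofrac; rewrite -[LHS]FracField.pi_mul; apply/eqmodP => /=.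
rewrite FracField.equivfE /FracField.mulf /=.
by rewrite !numden_Ratio ?oner_eq0 ?mulr1 //= mulrC.
Qed.

Lemma function_fieldP (f : function_field) :
  exists p q, polyF q != 0 /\ f = polyF p / polyF q.
Proof.
have [x [y [y0 ->]]] := fractionP f; exists (repr x), (repr y).
rewrite !polyF.unlock /poly_coord !reprK; split=> //; apply/eqP => e.
by have /eqP := y0; apply; apply/eqP; rewrite -tofrac_eq0; apply/eqP.
Qed.

(* A rational function f is defined at a if it can be written p / q with
   q(a) <> 0; the pair p, q may depend on a, and one such pair is chosen by
   fraction_at (valueE and differentialE: value, and differential on the
   tangent space, do not depend on the choice). *)
Definition is_fraction (f : function_field) (a : pt) (pq : poly * poly) : Prop :=
  ev pq.2 a != 0 /\ f = polyF pq.1 / polyF pq.2.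

Definition defined_at (f : function_field) (a : pt) : Prop :=
  exists pq, is_fraction f a pq.

Definition fraction_at (f : function_field) (a : pt) : poly * poly :=
  if pselect (defined_at f a) is left h then projT1 (cid h) else (0, 1).

Definition value (f : function_field) (a : pt) : K :=
  let pq := fraction_at f a in ev pq.1 a / ev pq.2 a.

(* Quotient rule for p / q. An individual partial derivative does depend on the
   representative p / q, as p and q are only determined modulo the ideal of X;
   the linear form that the partial derivatives define on the tangent space
   does not. *)
Definition partial_at (f : function_field) (j : 'I_n) (a : pt) : K :=
  let: (p, q) := fraction_at f a in
  (ev p^`M(j) a * ev q a - ev p a * ev q^`M(j) a) / ev q a ^+ 2.

Definition tangent_space (a : pt) : pt -> Prop := fun u =>
  forall p, p \in vanishing_ideal -> \sum_(j < n) ev p^`M(j) a * u ord0 j = 0.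

Definition differential (f : function_field) (a u : pt) : K :=
  \sum_(j < n) partial_at f j a * u ord0 j.

Section PointwiseTheory.
Implicit Types (f g : function_field) (a u : pt).

Definition grad (p : poly) (a u : pt) : K := \sum_(j < n) ev p^`M(j) a * u ord0 j.

Lemma grad0 a u : grad 0 a u = 0.
Proof. by rewrite /grad big1 // => j _; rewrite mderiv0 /ev meval0 mul0r. Qed.

Lemma gradB p q a u : grad (p - q) a u = grad p a u - grad q a u.
Proof.
rewrite /grad -sumrB; apply: eq_bigr => j _.
by rewrite mderivB /ev mevalB mulrBl.
Qed.

Lemma gradM p q a u : grad (p * q) a u = grad p a u * ev q a + ev p a * grad q a u.
Proof.
rewrite /grad mulr_suml mulr_sumr -big_split; apply: eq_bigr => j _ /=.
by rewrite mderivM /ev mevalD !mevalM; ring.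
Qed.

Lemma evM p q a : ev (p * q) a = ev p a * ev q a. Proof. exact: mevalM. Qed.
Lemma evB p q a : ev (p - q) a = ev p a - ev q a. Proof. exact: mevalB. Qed.

Lemma fraction_atP f a : defined_at f a -> is_fraction f a (fraction_at f a).
Proof. by rewrite /fraction_at => h; case: pselect => // h'; case: cid. Qed.

Lemma is_fraction_cross f a pq pq' : X a -> is_fraction f a pq ->
  is_fraction f a pq' -> pq.1 * pq'.2 - pq'.1 * pq.2 \in vanishing_ideal.
Proof.
case: pq pq' => [p q] [p' q'] Xa [/= q0 ->] [/= q0' /eqP].
rewrite eqr_div ?(polyF_neq0 Xa) // -subr_eq0 -!rmorphM -rmorphB polyF_eq0.
by [].
Qed.

Lemma valueE f a pq : X a -> is_fraction f a pq ->
  value f a = ev pq.1 a / ev pq.2 a.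
Proof.
move=> Xa fr; have := fraction_atP (ex_intro _ pq fr).
rewrite /value; case: (fraction_at f a) => p q fr'.
have /vanishingP/(_ a Xa) := is_fraction_cross Xa fr fr'.
case: fr fr' => q0 _ [/= q0' _]; rewrite evB !evM => /eqP; rewrite subr_eq0.
by move=> /eqP e; apply/eqP; rewrite eqr_div // e.
Qed.

Lemma differentialE f a u pq : X a -> tangent_space a u -> is_fraction f a pq ->
  differential f a u =
  (grad pq.1 a u * ev pq.2 a - ev pq.1 a * grad pq.2 a u) / ev pq.2 a ^+ 2.
Proof.
move=> Xa Tu fr; have := fraction_atP (ex_intro _ pq fr).
rewrite /differential /partial_at; case: (fraction_at f a) => p' q' fr'.
have -> : \sum_(j < n) (ev p'^`M(j) a * ev q' a - ev p' a * ev q'^`M(j) a)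
    / ev q' a ^+ 2 * u ord0 j =
  (grad p' a u * ev q' a - ev p' a * grad q' a u) / ev q' a ^+ 2.
  rewrite mulr_suml mulr_sumr -sumrB mulr_suml; apply: eq_bigr => j _; ring.
have I := is_fraction_cross Xa fr fr'.
have := Tu _ I; have /vanishingP/(_ a Xa) := I; rewrite -/(grad _ a u).
case: fr fr' => q0 _ [/= q0' _] {I}.
rewrite gradB !gradM evB !evM.
move: (ev pq.1 a) (ev pq.2 a) (ev p' a) (ev q' a) q0 q0' (grad pq.1 a u)
  (grad pq.2 a u) (grad p' a u) (grad q' a u) => P Q P' Q' Q0 Q0' dP dQ dP' dQ'.
move=> /eqP; rewrite subr_eq0 => /eqP e1 /eqP; rewrite subr_eq0 => /eqP e2.
have eP' : P' = P * Q' / Q by rewrite e1 mulfK.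
have edP' : dP' = (dP * Q' + P * dQ' - P' * dQ) / Q.
  by rewrite e2 addrK mulfK.
by rewrite edP' eP'; field; rewrite Q0 Q0'.
Qed.

Lemma is_fractionB f g a pq pq' : X a ->
  is_fraction f a pq -> is_fraction g a pq' ->
  is_fraction (f - g) a (pq.1 * pq'.2 - pq'.1 * pq.2, pq.2 * pq'.2).
Proof.
case: pq pq' => [p q] [p' q'] Xa [/= q0 ->] [/= q0' ->]; split => /=.
  by rewrite evM mulf_neq0.
by rewrite rmorphB !rmorphM subf_div ?(polyF_neq0 Xa).
Qed.

Lemma is_fractionM f g a pq pq' : X a ->
  is_fraction f a pq -> is_fraction g a pq' ->
  is_fraction (f * g) a (pq.1 * pq'.1, pq.2 * pq'.2).
Proof.
case: pq pq' => [p q] [p' q'] Xa [/= q0 ->] [/= q0' ->]; split => /=.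
  by rewrite evM mulf_neq0.
by rewrite !rmorphM /= mulf_div.
Qed.

Lemma is_fraction_poly p a : is_fraction (polyF p) a (p, 1).
Proof. by split=> /=; rewrite ?/ev ?meval1 ?oner_neq0 // rmorph1 divr1. Qed.

Lemma defined_poly p a : defined_at (polyF p) a.
Proof. by exists (p, 1); exact: is_fraction_poly. Qed.

Lemma value_poly p a : X a -> value (polyF p) a = ev p a.
Proof.
by move=> Xa; rewrite (valueE Xa (is_fraction_poly p a)) /= /ev meval1 divr1.
Qed.

Lemma value1 a : X a -> value 1 a = 1.
Proof. by move=> Xa; rewrite -(rmorph1 polyF) value_poly // /ev meval1. Qed.

Lemma defined1 a : defined_at 1 a.
Proof. by rewrite -(rmorph1 polyF); exact: defined_poly. Qed.

Lemma definedB f g a : X a ->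
  defined_at f a -> defined_at g a -> defined_at (f - g) a.
Proof. by move=> Xa [pq h] [pq' h']; eexists; apply: is_fractionB h h'. Qed.

Lemma definedM f g a : X a ->
  defined_at f a -> defined_at g a -> defined_at (f * g) a.
Proof. by move=> Xa [pq h] [pq' h']; eexists; apply: is_fractionM h h'. Qed.

Lemma valueB f g a : X a -> defined_at f a -> defined_at g a ->
  value (f - g) a = value f a - value g a.
Proof.
move=> Xa [pq h] [pq' h']; rewrite (valueE Xa (is_fractionB Xa h h')).
rewrite (valueE Xa h) (valueE Xa h') /= evB !evM.
by case: h h' => q0 _ [q0' _]; field; rewrite q0 q0'.
Qed.

Lemma valueM f g a : X a -> defined_at f a -> defined_at g a ->
  value (f * g) a = value f a * value g a.
Proof.
move=> Xa [pq h] [pq' h']; rewrite (valueE Xa (is_fractionM Xa h h')).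
rewrite (valueE Xa h) (valueE Xa h') /= !evM.
by case: h h' => q0 _ [q0' _]; field; rewrite q0 q0'.
Qed.

Lemma differentialB f g a u : X a -> tangent_space a u ->
  defined_at f a -> defined_at g a ->
  differential (f - g) a u = differential f a u - differential g a u.
Proof.
move=> Xa Tu [pq h] [pq' h'].
rewrite (differentialE Xa Tu (is_fractionB Xa h h')).
rewrite (differentialE Xa Tu h) (differentialE Xa Tu h') /=.
rewrite gradB !gradM evB !evM.
by case: h h' => q0 _ [q0' _]; field; rewrite q0 q0'.
Qed.

Lemma value0 a : X a -> value 0 a = 0.
Proof. by move=> Xa; rewrite -(rmorph0 polyF) value_poly // /ev meval0. Qed.

Lemma defined0 a : defined_at 0 a.
Proof. by rewrite -(rmorph0 polyF); exact: defined_poly. Qed.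

Lemma definedN f a : X a -> defined_at f a -> defined_at (- f) a.
Proof. by move=> Xa df; rewrite -sub0r; apply: definedB => //; exact: defined0. Qed.

Lemma valueN f a : X a -> defined_at f a -> value (- f) a = - value f a.
Proof.
by move=> Xa df; rewrite -sub0r valueB ?value0 ?sub0r //; exact: defined0.
Qed.

Lemma definedD f g a : X a ->
  defined_at f a -> defined_at g a -> defined_at (f + g) a.
Proof.
by move=> Xa df dg; rewrite -[g]opprK; apply: definedB => //; exact: definedN.
Qed.

Lemma valueD f g a : X a -> defined_at f a -> defined_at g a ->
  value (f + g) a = value f a + value g a.
Proof.
move=> Xa df dg; rewrite -[g]opprK valueB //; last exact: definedN.
by rewrite opprK valueN ?opprK.
Qed.

End PointwiseTheory.

(* P holds at every point of some nonempty Zariski open subset of X. *)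
Definition generically (P : pt -> Prop) : Prop :=
  exists U, [/\ zariski_open U, exists a, U a /\ X a &
                forall a, U a -> X a -> P a].

Lemma open_complement (h : poly) : zariski_open (fun a => ev h a != 0).
Proof.
exists (eq h) => a; split=> [/negP|/(_ h erefl) ->]; last by rewrite eqxx.
by rewrite negbK => /eqP h0 p <-.
Qed.

Lemma genericallyP (P : pt -> Prop) : generically P <->
  exists h, polyF h != 0 /\ forall a, X a -> ev h a != 0 -> P a.
Proof.
split=> [[U [[S US] [a [Ua Xa]] UP]]|[h [h0 hP]]].
  have /existsNP[p /not_implyP[Sp /eqP pa]] :
      ~ forall p, S p -> ev p a = 0 by move/(US a).
  exists p.
  split=> [|b Xb pb]; first exact: polyF_neq0 pa.
  apply: UP => //; apply: contrapT => /(US b)/(_ p Sp) p0.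
  by rewrite p0 eqxx in pb.
exists (fun a => ev h a != 0); split=> [||a ? ?]; [exact: open_complement| |exact: hP].
apply: contrapT => nex; move: h0; rewrite -[_ != 0]/(~~ (_ == 0)) => /negP[].
apply/polyF_eq0P => a Xa; apply: contrapT => /eqP ha; apply: nex.
by exists a.
Qed.

Lemma generically_and (P Q : pt -> Prop) :
  generically P -> generically Q -> generically (fun a => P a /\ Q a).
Proof.
move=> /genericallyP[h [h0 hP]] /genericallyP[k [k0 kQ]]; apply/genericallyP.
exists (h * k); split=> [|a Xa].
  by rewrite rmorphM mulf_eq0 negb_or h0 k0.
by rewrite evM mulf_eq0 negb_or => /andP[ha ka]; split; [apply: hP|apply: kQ].
Qed.

Lemma generically_sub (P Q : pt -> Prop) :
  generically P -> (forall a, X a -> P a -> Q a) -> generically Q.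
Proof. by move=> [U [oU neU UP]] PQ; exists U; split=> // a Ua Xa; apply/PQ/UP. Qed.

Lemma generically_defined f : generically (defined_at f).
Proof.
apply/genericallyP; have [p [q [q0 ->]]] := function_fieldP f.
by exists q; split=> // a Xa qa; exists (p, q).
Qed.

(* The list of the pairs (f_i, g_i) stands for the expression sum_i f_i dg_i. *)
Definition form_expr := seq (function_field * function_field).

Definition form_defined (w : form_expr) (a : pt) : Prop :=
  forall fg, fg \in w -> defined_at fg.1 a /\ defined_at fg.2 a.

Definition form_at (w : form_expr) (a u : pt) : K :=
  \sum_(fg <- w) value fg.1 a * differential fg.2 a u.

Definition form_eq (w1 w2 : form_expr) : Prop :=
  generically (fun a => [/\ form_defined w1 a, form_defined w2 a &
    forall u, tangent_space a u -> form_at w1 a u = form_at w2 a u]).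

Definition form_eqb (w1 w2 : form_expr) : bool := `[< form_eq w1 w2 >].

Lemma form_defined_cons fg w a : form_defined (fg :: w) a <->
  (defined_at fg.1 a /\ defined_at fg.2 a) /\ form_defined w a.
Proof.
split=> [h|[h1 h2] x]; last by rewrite inE => /predU1P[->|/h2].
by split=> [|x xw]; apply: h; rewrite inE ?eqxx ?xw ?orbT.
Qed.

Lemma form_defined_cat w1 w2 a : form_defined (w1 ++ w2) a <->
  form_defined w1 a /\ form_defined w2 a.
Proof.
split=> [h|[h1 h2] x]; last by rewrite mem_cat => /orP[/h1|/h2].
by split=> x xw; apply: h; rewrite mem_cat xw ?orbT.
Qed.

Lemma form_at_cat w1 w2 a u :
  form_at (w1 ++ w2) a u = form_at w1 a u + form_at w2 a u.
Proof. by rewrite /form_at big_cat. Qed.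

Lemma generically_form_defined w : generically (form_defined w).
Proof.
elim: w => [|[f g] w IH].
  by apply: generically_sub (generically_defined 0) _ => a _ _ x; rewrite in_nil.
have := generically_and (generically_and (generically_defined f)
  (generically_defined g)) IH.
by move/generically_sub; apply=> a _ h; apply/form_defined_cons.
Qed.

Lemma form_eq_pointwise w1 w2 :
  (forall a, X a -> form_defined w1 a -> form_defined w2 a ->
    forall u, tangent_space a u -> form_at w1 a u = form_at w2 a u) ->
  form_eq w1 w2.
Proof.
move=> h; apply: generically_sub (generically_and (generically_form_defined w1)
  (generically_form_defined w2)) _ => a Xa [d1 d2].
by split=> // u Tu; apply: h.
Qed.

Lemma form_eqb_refl : reflexive form_eqb.
Proof. by move=> w; apply/asboolP/form_eq_pointwise. Qed.

Lemma form_eqb_sym : ssrbool.symmetric form_eqb.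
Proof.
suff h w1 w2 : form_eq w1 w2 -> form_eq w2 w1.
  by move=> w1 w2; apply/asboolP/asboolP; apply: h.
move/generically_sub; apply=> a _ [d1 d2 e]; split=> // u Tu.
by rewrite e.
Qed.

Lemma form_eqb_trans : transitive form_eqb.
Proof.
move=> w2 w1 w3 /asboolP h12 /asboolP h23; apply/asboolP.
apply: generically_sub (generically_and h12 h23) _ => a _.
by move=> [[d1 _ e1] [_ d3 e2]]; split=> // u Tu; rewrite e1 ?e2.
Qed.

Canonical form_equiv := EquivRel form_eqb form_eqb_refl form_eqb_sym form_eqb_trans.
Canonical form_encModRel := defaultEncModRel form_eqb.

Definition Omega := {eq_quot form_eqb}.
HB.instance Definition _ := Quotient.on Omega.
HB.instance Definition _ := gen_eqMixin Omega.
HB.instance Definition _ := gen_choiceMixin Omega.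

End RationalFunctions.

HB.lock Definition mk_form (K : fieldType) (n : nat) (X : affine_variety K n)
    (w : form_expr X) : Omega X := \pi_(Omega X) w.

Section Forms.
Variables (K : fieldType) (n : nat) (X : affine_variety K n).
Local Notation poly := {mpoly K[n]}.
Local Notation pt := 'rV[K]_n.
Local Notation vanishing_ideal := (vanishing_ideal X).
Local Notation function_field := (function_field X).
Local Notation form_expr := (form_expr X).
Local Notation Omega := (Omega X).
Local Notation mk_form := (@mk_form K n X).
Local Notation generically := (generically X).
Local Notation tangent_space := (tangent_space X).

Lemma mk_formP w1 w2 : mk_form w1 = mk_form w2 <-> form_eq w1 w2.
Proof.
rewrite mk_form.unlock.
by split=> [/eqmodP/asboolP|h]; last exact/eqmodP/asboolP.
Qed.

Definition scale_expr (f : function_field) (w : form_expr) : form_expr :=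
  [seq (f * fg.1, fg.2) | fg <- w].

Lemma scale_expr_defined f w a : X a -> defined_at f a -> form_defined w a ->
  form_defined (scale_expr f w) a.
Proof.
move=> Xa df dw x /mapP[fg /dw[d1 d2] ->] /=; split=> //.
exact: definedM.
Qed.

Lemma scale_expr_at f w a u : X a -> defined_at f a -> form_defined w a ->
  form_at (scale_expr f w) a u = value f a * form_at w a u.
Proof.
move=> Xa df dw; rewrite /form_at big_map mulr_sumr !big_seq.
by apply: eq_bigr => fg /dw[d1 _] /=; rewrite valueM // mulrA.
Qed.

Definition Omega_zero : Omega := mk_form [::].
Definition Omega_add (v w : Omega) : Omega := mk_form (repr v ++ repr w).
Definition Omega_scale (f : function_field) (w : Omega) : Omega :=
  mk_form (scale_expr f (repr w)).
Definition Omega_opp (w : Omega) : Omega := Omega_scale (-1) w.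

Lemma repr_form w : form_eq (repr (mk_form w)) w.
Proof. by apply/mk_formP; rewrite {1}mk_form.unlock reprK. Qed.

Lemma Omega_ind (P : Omega -> Prop) : (forall w, P (mk_form w)) -> forall w, P w.
Proof. by move=> h w; have := h (repr w); rewrite mk_form.unlock reprK. Qed.

Lemma Omega_addE v w : Omega_add (mk_form v) (mk_form w) = mk_form (v ++ w).
Proof.
have hv := repr_form v.
have hw := repr_form w.
apply/mk_formP; apply: generically_sub (generically_and hv hw) _ => a Xa.
move=> [[d1 d2 e] [d1' d2' e']]; split; [exact/form_defined_cat..|] => u Tu.
by rewrite !form_at_cat e ?e'.
Qed.

Lemma Omega_scaleE f w : Omega_scale f (mk_form w) = mk_form (scale_expr f w).
Proof.
have hw := repr_form w.
apply/mk_formP.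
apply: generically_sub (generically_and (generically_defined f) hw) _.
move=> a Xa [df [d1 d2 e]]; split; [exact: scale_expr_defined..|] => u Tu.
by rewrite !scale_expr_at // e.
Qed.

Lemma Omega_addA : associative Omega_add.
Proof.
elim/Omega_ind=> u; elim/Omega_ind=> v; elim/Omega_ind=> w.
by rewrite !Omega_addE catA.
Qed.

Lemma Omega_addC : commutative Omega_add.
Proof.
elim/Omega_ind=> v; elim/Omega_ind=> w; rewrite !Omega_addE.
apply/mk_formP/form_eq_pointwise => a _ _ _ u _.
by rewrite !form_at_cat addrC.
Qed.

Lemma Omega_add0 : left_id Omega_zero Omega_add.
Proof. by elim/Omega_ind=> w; rewrite Omega_addE. Qed.

Lemma Omega_eqP w1 w2 (P : pt -> Prop) : generically P ->
  (forall a, X a -> P a -> form_defined w1 a -> form_defined w2 a ->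
    forall u, tangent_space a u -> form_at w1 a u = form_at w2 a u) ->
  mk_form w1 = mk_form w2.
Proof.
move=> gP h; apply/mk_formP.
apply: generically_sub (generically_and gP (generically_and
  (generically_form_defined w1) (generically_form_defined w2))) _.
by move=> a Xa [Pa [d1 d2]]; split=> // u Tu; apply: h.
Qed.

Lemma Omega_addN : left_inverse Omega_zero Omega_opp Omega_add.
Proof.
elim/Omega_ind=> w; rewrite /Omega_opp Omega_scaleE Omega_addE.
apply: (Omega_eqP (generically_form_defined w)) => a Xa dw _ _ u _.
have d1 := definedN Xa (defined1 X a).
rewrite form_at_cat scale_expr_at // valueN ?value1 //; last exact: defined1.
by rewrite /form_at big_nil mulN1r addNr.
Qed.

HB.instance Definition _ :=
  GRing.isZmodule.Build Omega Omega_addA Omega_addC Omega_add0 Omega_addN.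

Lemma mk_formD v w : mk_form v + mk_form w = mk_form (v ++ w).
Proof. exact: Omega_addE. Qed.

Lemma Omega_scaleA f g w :
  Omega_scale f (Omega_scale g w) = Omega_scale (f * g) w.
Proof.
elim/Omega_ind: w => w; rewrite !Omega_scaleE /scale_expr -map_comp.
by congr mk_form; apply: eq_map => x /=; rewrite mulrA.
Qed.

Lemma Omega_scale1 : left_id 1 Omega_scale.
Proof.
elim/Omega_ind=> w; rewrite Omega_scaleE; congr mk_form.
by rewrite -[RHS]map_id; apply: eq_map => -[x y] /=; rewrite mul1r.
Qed.

Lemma Omega_scaleDr : right_distributive Omega_scale +%R.
Proof.
move=> f; elim/Omega_ind=> v; elim/Omega_ind=> w.
by rewrite mk_formD !Omega_scaleE mk_formD /scale_expr map_cat.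
Qed.

Lemma Omega_scaleDl w : {morph Omega_scale^~ w : f g / f + g}.
Proof.
move=> f g; elim/Omega_ind: w => w; rewrite !Omega_scaleE mk_formD.
apply: (Omega_eqP (generically_and (generically_and (generically_defined f)
  (generically_defined g)) (generically_form_defined w))).
move=> a Xa [[df dg] dw] _ _ u _; have dfg := definedD Xa df dg.
by rewrite form_at_cat !scale_expr_at // valueD // mulrDl.
Qed.

HB.instance Definition _ := GRing.Zmodule_isLmodule.Build function_field Omega
  Omega_scaleA Omega_scale1 Omega_scaleDr Omega_scaleDl.

Definition dform (f : function_field) : Omega := mk_form [:: (1, f)].

Lemma mk_formE w : mk_form w = \sum_(fg <- w) fg.1 *: dform fg.2.
Proof.
elim: w => [|[f g] w IH]; first by rewrite big_nil.
rewrite big_cons -IH -[_ *: _]/(Omega_scale _ _) /dform Omega_scaleE /= mk_formD.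
by rewrite mulr1.
Qed.

Lemma dformB f g : dform (f - g) = dform f - dform g.
Proof.
apply: (canRL (addrK _)); rewrite mk_formD.
apply: (Omega_eqP (generically_and (generically_defined f)
  (generically_defined g))) => a Xa [df dg] _ _ u Tu.
rewrite /form_at /= !big_cons !big_nil /= value1 // !mul1r !addr0.
by rewrite differentialB // subrK.
Qed.

HB.instance Definition _ := GRing.isZmodMorphism.Build function_field Omega dform dformB.

Definition exact_pred : {pred Omega} := fun w => `[< exists f, w = dform f >].

Lemma exact_zmod_closed : zmod_closed exact_pred.
Proof.
split=> [|v w /asboolP[f ->] /asboolP[g ->]]; apply/asboolP.
  by exists 0; rewrite raddf0.
by exists (f - g); rewrite raddfB.
Qed.

HB.instance Definition _ := GRing.isZmodClosed.Build Omega exact_pred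
  exact_zmod_closed.

(* The additive group of the forms df, f in K(X). *)
Record exact_form := ExactForm {
  exact_val :> Omega;
  exact_valP : exact_val \in exact_pred
}.

HB.instance Definition _ := [isSub for exact_val].
HB.instance Definition _ := [Choice of exact_form by <:].
HB.instance Definition _ := [SubChoice_isSubZmodule of exact_form by <:].

Lemma dform_exact f : dform f \in exact_pred.
Proof. by apply/asboolP; exists f. Qed.

Definition exact_d (f : function_field) : exact_form := ExactForm (dform_exact f).

End Forms.

(* Main.v *)
Require Import Defs.
From HB Require Import structures.
From mathcomp Require Import all_boot all_algebra.
From mathcomp Require Import boolp mpoly ring.

Set Implicit Arguments.
Unset Strict Implicit.
Unset Printing Implicit Defensive.

Import GRing.Theory.
Local Open Scope ring_scope.

(** Write L for K(X). The natural candidate for D^1 is the Lie derivative along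
    der', namely
      sum_i f_i dg_i |-> sum_i (der' f_i) dg_i + f_i d(der' g_i),
    and the whole difficulty is that it depends only on the form, where equality
    of forms means equality as linear forms on the tangent spaces at the points
    of a nonempty open subset.

    Equality of forms is first made algebraic, by duality with the K-derivations
    D of L: a form sum_i f_i dg_i vanishes if and only if all its contractions
    sum_i f_i D(g_i) do ([mk_form_eq0]). A K-derivation is the same thing as a
    vector field (D x_j)_j tangent to X, that is, a solution over L of the linear
    system with one row grad p for each p in the ideal of X
    ([K_derivation_of_tangent_field]); and a form is generically given by a
    linear form H in these coordinates ([form_gradient]). If the form vanishes,
    evaluating H at the tangent vectors ((D x_j)(a))_j shows that the contraction
    with D is zero. Conversely, if all contractions vanish then H annihilates all
    solutions of the system, hence is a combination over L of finitely many rows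
    grad p ([span_of_annihilator]), and each of these vanishes on every tangent
    space.

    Let D be a K-derivation of L. As der' maps K to K, the bracket [der', D] is
    again a K-derivation, and the contraction of the Lie derivative of w with D
    is der' applied to the contraction of w with D, minus the contraction of w
    with [der', D] ([contraction_lie]). So all contractions of the Lie derivative
    are determined by those of w, hence by the form alone. The module axioms and
    uniqueness are then formal, the exact forms generating all forms over L. *)

(** * Derivations of a field *)

(** Leibniz maps with values in a field, their source acting through [phi]:
    derivations of polynomials into the function field are of this kind. *)
Definition derivation_along (R : nzRingType) (F : fieldType) (phi d : R -> F) :=
  (forall p q, d (p + q) = d p + d q) /\
  (forall p q, d (p * q) = phi p * d q + d p * phi q).

Section Derivations.
Variables (F : fieldType) (D : F -> F).
Hypothesis hD : is_derivation D.

Lemma derivation0 : D 0 = 0.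
Proof. by apply: (addrI (D 0)); rewrite -hD.1 !addr0. Qed.

Lemma derivation1 : D 1 = 0.
Proof.
by apply: (addrI (D 1)); rewrite addr0 -{3}(mulr1 1) hD.2 mulr1 mul1r.
Qed.

Lemma derivation_div x y : y != 0 -> D (x / y) = (D x * y - x * D y) / y ^+ 2.
Proof.
move=> y0; have := hD.2 (x / y) y; rewrite divfK // => ->.
by field.
Qed.

Lemma derivation_sum (I : Type) (r : seq I) (f : I -> F) :
  D (\sum_(i <- r) f i) = \sum_(i <- r) D (f i).
Proof. exact: (big_morph D hD.1 derivation0). Qed.

End Derivations.

Definition bracket (F : fieldType) (d D : F -> F) f := d (D f) - D (d f).

Lemma bracket_derivation (F : fieldType) (d D : F -> F) :
  is_derivation d -> is_derivation D -> is_derivation (bracket d D).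
Proof.
move=> hd hD; split=> f g; rewrite /bracket.
  by rewrite hD.1 !hd.1 hD.1 opprD addrACA.
by rewrite hD.2 hd.1 !hd.2 hD.1 !hD.2; ring.
Qed.

(** The identity behind Cartan's formula for the Lie derivative of f dg. *)
Lemma bracket_Leibniz (F : fieldType) (d D : F -> F) (f g : F) :
  is_derivation d ->
  d f * D g + f * D (d g) = d (f * D g) - f * bracket d D g.
Proof. by move=> hd; rewrite hd.2 /bracket; ring. Qed.

Section DerivationAlong.
Variables (R : comNzRingType) (F : fieldType) (phi : {rmorphism R -> F}).
Variable d : R -> F.
Hypothesis hd : derivation_along phi d.

Lemma derivation_along1 : d 1 = 0.
Proof.
by apply: (addrI (d 1)); rewrite addr0 -{3}(mulr1 1) hd.2 rmorph1 mulr1 mul1r.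
Qed.

Lemma derivation_alongB p q : d (p - q) = d p - d q.
Proof. by apply: (canRL (addrK _)); rewrite -hd.1 subrK. Qed.

Let quotient_rule p q := (d p * phi q - phi p * d q) / phi q ^+ 2.

Hypothesis d_ker : forall p, phi p = 0 -> d p = 0.

(* p / q = p' / q' says that p q' - p' q is in the kernel of phi, hence killed by
   d; this is a linear equation giving d p' in terms of d p, d q and d q'. *)
Let quotient_rule_unique p q p' q' : phi q != 0 -> phi q' != 0 ->
  phi p / phi q = phi p' / phi q' -> quotient_rule p q = quotient_rule p' q'.
Proof.
move=> q0 q0' /eqP; rewrite eqr_div // => /eqP e.
have : d (p * q' - p' * q) = 0 by apply: d_ker; rewrite rmorphB !rmorphM e subrr.
rewrite derivation_alongB !hd.2 => /eqP; rewrite subr_eq0 => /eqP e'.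
rewrite /quotient_rule.
have {e'}-> : d p' = (phi p * d q' + d p * phi q' - phi p' * d q) / phi q.
  by rewrite e' addrC addKr mulfK.
have -> : phi p' = phi p * phi q' / phi q by rewrite e mulfK.
by field; rewrite q0 q0'.
Qed.

(** A derivation that kills the kernel of [phi] passes to the fractions of the
    image of [phi] by the quotient rule. *)
Lemma derivation_extends :
  (forall f : F, exists p q, phi q != 0 /\ f = phi p / phi q) ->
  exists D : F -> F, is_derivation D /\ forall p, D (phi p) = d p.
Proof.
move=> frac.
have /choice[nd ndP] f : exists pq, phi pq.2 != 0 /\ f = phi pq.1 / phi pq.2.
  by have [p [q h]] := frac f; exists (p, q).
pose D f := quotient_rule (nd f).1 (nd f).2.
have DE p q : phi q != 0 -> D (phi p / phi q) = quotient_rule p q.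
  move=> q0; rewrite /D; have [] := ndP (phi p / phi q).
  by move=> q0' e; apply: quotient_rule_unique.
exists D; split; last first.
  move=> p; rewrite -[phi p]divr1 -(rmorph1 phi) DE ?rmorph1 ?oner_eq0 //.
  by rewrite /quotient_rule derivation_along1 rmorph1 mulr0 subr0 expr1n !mulr1 divr1.
split=> f g; have [p [q [q0 ->]]] := frac f; have [p' [q' [q0' ->]]] := frac g.
- rewrite addf_div // -!rmorphM -rmorphD !DE ?rmorphM ?mulf_neq0 //.
  rewrite /quotient_rule hd.1 !hd.2 !rmorphD !rmorphM.
  by field; rewrite q0 q0'.
rewrite mulf_div -!rmorphM !DE ?rmorphM ?mulf_neq0 //.
rewrite /quotient_rule !hd.2 !rmorphM.
by field; rewrite q0 q0'.
Qed.

End DerivationAlong.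

Lemma mderiv_var (K : fieldType) (n : nat) (i j : 'I_n) :
  mderiv j ('X_i : {mpoly K[n]}) = (i == j)%:R.
Proof.
rewrite mderivX mnm1E; case: eqVneq => [<-|_]; last by rewrite scale0r.
have -> : (U_(i) - U_(i) = 0 :> 'X_{1..n})%MM.
  by rewrite -[X in (X - _)%MM]add0m addmK.
by rewrite scale1r mpolyX0.
Qed.

Lemma derivation_along_mpoly (K F : fieldType) (n : nat)
    (phi : {rmorphism {mpoly K[n]} -> F}) (d : {mpoly K[n]} -> F) :
  derivation_along phi d -> (forall c, d c%:MP = 0) ->
  forall p, d p = \sum_(j < n) phi (mderiv j p) * d 'X_j.
Proof.
move=> hd dC; pose ok p := d p = \sum_(j < n) phi (mderiv j p) * d 'X_j.
have okC c : ok c%:MP.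
  by rewrite /ok dC big1 // => j _; rewrite mderivC rmorph0 mul0r.
have okD p q : ok p -> ok q -> ok (p + q).
  rewrite /ok hd.1 => -> ->; rewrite -big_split; apply: eq_bigr => j _ /=.
  by rewrite mderivD rmorphD mulrDl.
have okM p q : ok p -> ok q -> ok (p * q).
  rewrite /ok hd.2 => -> ->; rewrite mulr_sumr mulr_suml -big_split.
  by apply: eq_bigr => j _ /=; rewrite mderivM rmorphD !rmorphM; ring.
have okX i : ok 'X_i.
  rewrite /ok (bigD1 i) //= big1 ?addr0 => [|j ji]; rewrite mderiv_var.
    by rewrite eqxx rmorph1 mul1r.
  by rewrite eq_sym (negPf ji) rmorph0 mul0r.
elim/mpolyind=> [|c m p _ _ okp]; first exact: (okC 0).
apply: (okD) => //; rewrite -mul_mpolyC mpolyXE_id; apply: (okM) => //.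
elim/big_ind: _ => [||i _]; [exact: (okC 1)|exact: (okM)|].
elim: (m i) => [|k IH]; first exact: (okC 1).
by rewrite exprS; apply: (okM).
Qed.

(** * Duality over a field *)

(** Finite-dimensional biduality: the linear forms vanishing on the common zeros
    of a possibly infinite family S are the combinations of members of S. A
    finite matrix with rows in S and maximal rank already spans S. *)
Lemma span_of_annihilator (F : fieldType) (n : nat) (S : 'rV[F]_n -> Prop)
    (h : 'rV[F]_n) :
  (forall u : 'cV_n, (forall s, S s -> s *m u = 0) -> h *m u = 0) ->
  exists m (c : 'rV_m) (A : 'M_(m, n)), (forall i, S (row i A)) /\ h = c *m A.
Proof.
move=> hS.
pose P r := `[< exists m (A : 'M[F]_(m, n)), (forall i, S (row i A)) /\ \rank A = r >].
have P0 : exists r, P r.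
  by exists 0; apply/asboolP; exists 0, 0; split=> [[]//|]; rewrite mxrank0.
have Pn r : P r -> (r <= n)%N by move=> /asboolP[m [A [_ <-]]]; exact: rank_leq_col.
case: (ex_maxnP P0 Pn) => r /asboolP[m [A [SA rA]]] rmax.
have subA s : S s -> (s <= A)%MS.
  move=> Ss; have sub : (A <= col_mx A s)%MS by rewrite -addsmxE addsmxSl.
  have: (col_mx A s <= A)%MS.
    rewrite -(geq_leqif (mxrank_leqif_sup sub)) rA; apply: rmax.
    apply/asboolP; exists (m + 1)%N, (col_mx A s); split=> // i.
    by case: (split_ordP i) => k ->; rewrite ?rowKu // rowKd ord1 row_id.
  by apply: submx_trans; rewrite -addsmxE addsmxSr.
have /submxP[c hc] : (h <= A)%MS.
  (* the columns of the cokernel of A are common zeros of S *)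
  rewrite submxE; apply/eqP/matrixP => i j; rewrite !mxE.
  have /matrixP/(_ ord0 ord0) : h *m col j (cokermx A) = 0.
    apply: hS => s /subA; rewrite submxE colE mulmxA => /eqP ->.
    by rewrite mul0mx.
  by rewrite [i]ord1 !mxE; under eq_bigr do rewrite mxE.
by exists m, c, A.
Qed.

(** * Derivations and forms on a variety *)

(** The coefficient of x = D x_j in D (p / q), when dp and dq are the partial
    derivatives of p and q in the variable x_j. *)
Lemma quotient_rule_coefficient (F : fieldType) (p q dp dq x : F) :
  (dp * x * q - p * (dq * x)) / q ^+ 2 = (dp * q - p * dq) / (q * q) * x.
Proof. by rewrite -expr2; ring. Qed.

Section RationalForms.
Variables (K : fieldType) (n : nat) (X : affine_variety K n).
Local Notation L := (function_field X).
Local Notation polyF := (@polyF K n X).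
Implicit Types (f g : L) (v w : form_expr X) (D : L -> L).

Definition K_derivation D := is_derivation D /\ forall c, D (scalarF X c) = 0.

Lemma K_derivation_polyF D : K_derivation D ->
  forall p, D (polyF p) = \sum_(j < n) polyF (mderiv j p) * D (polyF 'X_j).
Proof.
move=> [[DD DM] DK].
apply: (derivation_along_mpoly (phi := polyF) (d := fun p => D (polyF p))) => //.
split=> p q; first by rewrite rmorphD DD.
by rewrite rmorphM DM.
Qed.

(** The rational vector fields tangent to X are the K-derivations of K(X): the
    tangency condition says that the derivation of polynomials with values u_j on
    the variables kills the ideal of X. *)
Lemma K_derivation_of_tangent_field (u : 'I_n -> L) :
  (forall p, p \in vanishing_ideal X -> \sum_(j < n) polyF (mderiv j p) * u j = 0) ->
  exists D, K_derivation D /\ forall j, D (polyF 'X_j) = u j.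
Proof.
move=> tu; pose d p := \sum_(j < n) polyF (mderiv j p) * u j.
have dd : derivation_along polyF d.
  split=> p q; rewrite /d.
    by rewrite -big_split; apply: eq_bigr => j _; rewrite mderivD rmorphD mulrDl.
  rewrite mulr_sumr mulr_suml -big_split; apply: eq_bigr => j _ /=.
  rewrite mderivM rmorphD !rmorphM mulrDl addrC mulrA; congr (_ + _).
  by rewrite mulrAC.
have d0 p : polyF p = 0 -> d p = 0.
  by move/eqP; rewrite polyF_eq0; exact: tu.
have [D [hD De]] := derivation_extends dd d0 (@function_fieldP _ _ X).
exists D; split=> [|i].
  split=> // c; rewrite De /d big1 // => j _.
  by rewrite mderivC rmorph0 mul0r.
rewrite De /d (bigD1 i) //= big1 ?addr0 => [|j ji]; rewrite mderiv_var.
  by rewrite eqxx rmorph1 mul1r.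
by rewrite eq_sym (negPf ji) rmorph0 mul0r.
Qed.

Local Notation generically := (generically X).
Local Notation pt := 'rV[K]_n.

Lemma generically_forall (I : finType) (P : I -> pt -> Prop) :
  (forall i, generically (P i)) -> generically (fun a => forall i, P i a).
Proof.
move=> gP; suff h (s : seq I) : generically (fun a => forall i, i \in s -> P i a).
  apply: generically_sub (h (enum I)) _ => a _ Pa i; apply: Pa.
  by rewrite mem_enum.
elim: s => [|i s IH].
  by apply: generically_sub (generically_defined 0) _ => a _ _ i; rewrite in_nil.
apply: generically_sub (generically_and (gP i) IH) _ => a _ [Pi Ps] k.
by rewrite inE => /predU1P[->|/Ps].
Qed.

Lemma value_sum (I : finType) (f : I -> L) a : X a ->
  (forall i, defined_at (f i) a) ->
  value (\sum_i f i) a = \sum_i value (f i) a.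
Proof.
move=> Xa df; suff [] : defined_at (\sum_i f i) a /\
  value (\sum_i f i) a = \sum_i value (f i) a by [].
elim/big_rec2: _ => [|i y g _ [dg <-]]; first by split; [exact: defined0|exact: value0].
by split; [exact: definedD|rewrite valueD].
Qed.

Lemma value_dot (I : finType) (f g : I -> L) a : X a ->
  (forall i, defined_at (f i) a) -> (forall i, defined_at (g i) a) ->
  value (\sum_i f i * g i) a = \sum_i value (f i) a * value (g i) a.
Proof.
move=> Xa df dg; rewrite value_sum // => [|i]; last exact: definedM.
by apply: eq_bigr => i _; rewrite valueM.
Qed.

(** A rational function p / q that is zero on the locus h <> 0 makes p q h vanish
    on X, and the ideal of X is prime. *)
Lemma generically_value_eq0 f : generically (fun a => value f a = 0) -> f = 0.
Proof.
move=> /genericallyP[h [h0 hf]]; have [p [q [q0 ef]]] := function_fieldP f.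
suff : polyF (p * q * h) == 0.
  rewrite !rmorphM !mulf_eq0 (negPf h0) (negPf q0) !orbF ef => /eqP ->.
  exact: mul0r.
apply/polyF_eq0P => a Xa; rewrite !evM.
have [->|ha] := eqVneq (ev h a) 0; first by rewrite mulr0.
have [->|qa] := eqVneq (ev q a) 0; first by rewrite mulr0 mul0r.
have fr : is_fraction f a (p, q) by [].
have := hf a Xa ha; rewrite (valueE Xa fr) /= => /eqP.
by rewrite mulf_eq0 invr_eq0 (negPf qa) orbF => /eqP ->; rewrite !mul0r.
Qed.

(** One row G computes both the action of all K-derivations on g and, at general
    points, the differential of g. It comes from one expression p / q of g valid
    on the open set q <> 0, whereas the partial derivatives defining the
    differential use a fraction chosen point by point. *)
Lemma differential_gradient g : exists G : 'I_n -> L,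
  (forall D, K_derivation D -> D g = \sum_(j < n) G j * D (polyF 'X_j)) /\
  generically (fun a => (forall j, defined_at (G j) a) /\
    forall u, tangent_space X a u ->
      differential g a u = \sum_(j < n) value (G j) a * u ord0 j).
Proof.
have [p [q [q0 ->]]] := function_fieldP g.
pose N j := mderiv j p * q - p * mderiv j q.
exists (fun j => polyF (N j) / polyF (q * q)); split=> [D hD|].
  rewrite (derivation_div hD.1) // !(K_derivation_polyF hD).
  rewrite mulr_suml mulr_sumr -sumrB mulr_suml; apply: eq_bigr => j _.
  by rewrite rmorphB !rmorphM quotient_rule_coefficient.
apply/genericallyP; exists q; split=> // a Xa qa.
have fr j : is_fraction (polyF (N j) / polyF (q * q)) a (N j, q * q).
  by split=> //=; rewrite evM mulf_neq0.
split=> [j|u Tu]; first by exists (N j, q * q).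
have frg : is_fraction (polyF p / polyF q) a (p, q) by [].
rewrite (differentialE Xa Tu frg) /= /grad.
rewrite mulr_suml mulr_sumr -sumrB mulr_suml; apply: eq_bigr => j _.
by rewrite (valueE Xa (fr j)) /= evB !evM -expr2; ring.
Qed.

Definition contraction D w : L := \sum_(fg <- w) fg.1 * D fg.2.

Lemma form_gradient w : exists H : 'I_n -> L,
  (forall D, K_derivation D ->
    contraction D w = \sum_(j < n) H j * D (polyF 'X_j)) /\
  generically (fun a => (forall j, defined_at (H j) a) /\
    forall u, tangent_space X a u ->
      form_at w a u = \sum_(j < n) value (H j) a * u ord0 j).
Proof.
elim: w => [|[f g] w [H [HD HA]]].
  exists (fun=> 0); split=> [D _|].
    by rewrite /contraction big_nil big1 // => j _; rewrite mul0r.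
  apply: generically_sub (generically_defined 0) _ => a Xa _.
  split=> [j|u _]; first exact: defined0.
  by rewrite /form_at big_nil big1 // => j _; rewrite value0 ?mul0r.
have [G [GD GA]] := differential_gradient g.
exists (fun j => f * G j + H j); split=> [D hD|].
  rewrite /contraction big_cons -/(contraction D w) HD // GD // mulr_sumr.
  by rewrite -big_split; apply: eq_bigr => j _; rewrite mulrDl mulrA.
have := generically_and (generically_defined f) (generically_and GA HA).
move/generically_sub; apply=> a Xa [df [[dG eG] [dH eH]]].
have dfG j : defined_at (f * G j) a by exact: definedM.
split=> [j|u Tu]; first exact: definedD.
rewrite /form_at big_cons -/(form_at w a u) eH // eG // mulr_sumr -big_split.
by apply: eq_bigr => j _ /=; rewrite valueD // valueM // mulrDl mulrA.
Qed.

(** The values of the D x_j at a general point form a tangent vector there, on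
    which the form takes the value of the contraction. *)
Lemma contraction_eq0 w D : mk_form w = 0 -> K_derivation D -> contraction D w = 0.
Proof.
have [H [HD HA]] := form_gradient w.
rewrite -[0 : Omega X]/(mk_form [::]) mk_formP => w0 hD.
apply: generically_value_eq0; rewrite HD //.
have dx := generically_forall (fun j => generically_defined (D (polyF 'X_j))).
apply: generically_sub (generically_and dx (generically_and HA w0)) _.
move=> a Xa [dxa [[dH eH] [_ _ wa]]]; rewrite value_dot //.
pose u : pt := \row_j value (D (polyF 'X_j)) a.
have Tu : tangent_space X a u.
  move=> p pI; rewrite -[RHS](value0 Xa) -(derivation0 hD.1).
  have /eqP <- : polyF p == 0 by rewrite polyF_eq0.
  rewrite (K_derivation_polyF hD) value_dot // => [|j]; last exact: defined_poly.
  by apply: eq_bigr => j _; rewrite mxE value_poly.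
have := wa u Tu; rewrite eH // /form_at big_nil => u0; rewrite -[RHS]u0.
by apply: eq_bigr => j _; rewrite mxE.
Qed.

(** A form killed by all tangent fields is, at general points, a combination of
    gradients of equations of X, and these vanish on tangent spaces. *)
Lemma mk_form_eq0_of_contraction w :
  (forall D, K_derivation D -> contraction D w = 0) -> mk_form w = 0.
Proof.
have [H [HD HA]] := form_gradient w => cw0.
rewrite -[0 : Omega X]/(mk_form [::]) mk_formP.
pose S (s : 'rV[L]_n) :=
  exists2 p, p \in vanishing_ideal X & s = \row_j polyF (mderiv j p).
have [u Su|m [c [A [SA eH]]]] := @span_of_annihilator L n S (\row_j H j).
  have [p pI|D [hD De]] := @K_derivation_of_tangent_field (fun j => u j ord0).
    have /matrixP/(_ ord0 ord0) := Su _ (ex_intro2 _ _ p pI erefl).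
    by rewrite !mxE => u0; rewrite -[RHS]u0; apply: eq_bigr => j _; rewrite !mxE.
  apply/matrixP => i k; rewrite [i]ord1 [k]ord1 !mxE -[RHS](cw0 D hD) HD //.
  by apply: eq_bigr => j _; rewrite !mxE De.
have /choice[p pP] i : exists p, p \in vanishing_ideal X /\
    forall j, A i j = polyF (mderiv j p).
  have [p pI e] := SA i; exists p; split=> // j.
  by move/matrixP: e => /(_ ord0 j); rewrite !mxE.
have eHj j : H j = \sum_i c ord0 i * polyF (mderiv j (p i)).
  move/matrixP: eH => /(_ ord0 j); rewrite !mxE => ->.
  by apply: eq_bigr => i _; rewrite (pP i).2.
have gc := generically_forall (fun i => generically_defined (c ord0 i)).
apply: generically_sub (generically_and (generically_form_defined w)
  (generically_and gc HA)) _ => a Xa [dw [dc [dH eHa]]].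
split=> [//|fg|u Tu]; first by rewrite in_nil.
rewrite eHa // [RHS]/form_at big_nil.
transitivity (\sum_i value (c ord0 i) a *
    \sum_(j < n) ev (mderiv j (p i)) a * u ord0 j).
  under [RHS]eq_bigr do rewrite mulr_sumr.
  rewrite [RHS]exchange_big; apply: eq_bigr => j _ /=.
  rewrite eHj value_dot // => [|i]; last exact: defined_poly.
  by rewrite mulr_suml; apply: eq_bigr => i _; rewrite value_poly // mulrA.
by apply: big1 => i _; rewrite Tu ?mulr0 //; exact: (pP i).1.
Qed.

Lemma mk_form_eq0 w :
  mk_form w = 0 <-> forall D, K_derivation D -> contraction D w = 0.
Proof.
by split=> [w0 D|]; [exact: contraction_eq0|exact: mk_form_eq0_of_contraction].
Qed.

End RationalForms.

(** * The Lie derivative of forms *)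

Section LieDerivative.
Variables (K : fieldType) (n : nat) (X : affine_variety K n).
Local Notation L := (function_field X).
Implicit Types (f g : L) (v w : form_expr X) (D : L -> L).

Lemma contraction_cat D v w : contraction D (v ++ w) = contraction D v + contraction D w.
Proof. exact: big_cat. Qed.

Lemma contraction_scale D f w : contraction D (scale_expr f w) = f * contraction D w.
Proof.
by rewrite /contraction big_map mulr_sumr; apply: eq_bigr => fg _; rewrite mulrA.
Qed.

Lemma mk_form_scale f w : mk_form (scale_expr f w) = f *: mk_form w.
Proof. by rewrite -[RHS]/(Omega_scale _ _) Omega_scaleE. Qed.

Lemma mk_form_eq v w : mk_form v = mk_form w <->
  forall D, K_derivation D -> contraction D v = contraction D w.
Proof.
have -> : mk_form v = mk_form w <-> mk_form (v ++ scale_expr (-1) w) = 0.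
  rewrite -mk_formD mk_form_scale scaleN1r.
  by split=> [->|/eqP]; [exact: subrr|rewrite subr_eq0 => /eqP].
rewrite mk_form_eq0; split=> h D hD; move: (h D hD);
  rewrite contraction_cat contraction_scale mulN1r.
  by move/eqP; rewrite subr_eq0 => /eqP.
by move=> ->; exact: subrr.
Qed.

Variables (der : K -> K) (der' : L -> L).
Hypothesis hder' : is_derivation der'.
Hypothesis hext : forall c, der' (scalarF X c) = scalarF X (der c).

(** Both composites kill K, because [der'] maps K into K and D vanishes on K. *)
Lemma bracket_K_derivation D : K_derivation D -> K_derivation (bracket der' D).
Proof.
move=> [hD DK]; split; first exact: bracket_derivation.
by move=> c; rewrite /bracket hext !DK derivation0 // subrr.
Qed.

Definition lie_expr w : form_expr X :=
  [seq (der' fg.1, fg.2) | fg <- w] ++ [seq (fg.1, der' fg.2) | fg <- w].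

(** Cartan's formula: the contractions of the Lie derivative of a form are
    expressed through contractions of the form itself, so they do not depend on
    the expression chosen for it. *)
Lemma contraction_lie D w :
  contraction D (lie_expr w) = der' (contraction D w) - contraction (bracket der' D) w.
Proof.
rewrite contraction_cat /contraction !big_map (derivation_sum hder') -sumrB -big_split.
by apply: eq_bigr => fg _; apply: bracket_Leibniz.
Qed.

Definition lie (w : Omega X) : Omega X := mk_form (lie_expr (repr w)).

Lemma lie_mk_form w : lie (mk_form w) =
  \sum_(fg <- w) (der' fg.1 *: dform fg.2 + fg.1 *: dform (der' fg.2)).
Proof.
transitivity (mk_form (lie_expr w)).
  apply/mk_form_eq => D hD; rewrite !contraction_lie.
  have /mk_form_eq e : mk_form (repr (mk_form w)) = mk_form w by apply/mk_formP/repr_form.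
  by rewrite e // (e _ (bracket_K_derivation hD)).
by rewrite mk_formE big_cat !big_map big_split.
Qed.

Lemma lie_dform f : lie (dform f) = dform (der' f).
Proof. by rewrite lie_mk_form big_seq1 derivation1 // scale0r add0r scale1r. Qed.

Lemma lie_delta_module : is_delta_module der' lie.
Proof.
split=> [|c].
  elim/Omega_ind=> v; elim/Omega_ind=> w.
  by rewrite mk_formD !lie_mk_form big_cat.
elim/Omega_ind=> w; rewrite -mk_form_scale !lie_mk_form big_map mk_formE.
rewrite !scaler_sumr -big_split; apply: eq_bigr => fg _ /=.
by rewrite hder'.2 scalerDl scalerDr !scalerA [RHS]addrAC.
Qed.

(** The exact forms span all forms over K(X). *)
Lemma delta_module_unique (D1 D2 : Omega X -> Omega X) :
  is_delta_module der' D1 -> is_delta_module der' D2 ->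
  (forall f, D1 (dform f) = D2 (dform f)) -> D1 = D2.
Proof.
move=> [a1 s1] [a2 s2] e; apply: funext; elim/Omega_ind=> w.
rewrite mk_formE; elim: w => [|fg w IH]; last by rewrite big_cons a1 a2 s1 s2 e IH.
rewrite big_nil.
have D0 (E : Omega X -> Omega X) : {morph E : x y / x + y} -> E 0 = 0.
  by move=> Ea; apply: (addrI (E 0)); rewrite -Ea !addr0.
by rewrite !D0.
Qed.

End LieDerivative.

Theorem corollary2p3 (K : closedFieldType) (charK0 : [pchar K] =i pred0)
    (der : K -> K) (hder : is_derivation der)
    (n : nat) (X : affine_variety K n)
    (der' : function_field X -> function_field X)
    (hder' : is_derivation der')
    (hext : forall c : K, der' (scalarF X c) = scalarF X (der c)) :
  (forall f1 f2 : function_field X,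
     dform f1 = dform f2 -> dform (der' f1) = dform (der' f2)) /\
  exists D0 : {additive exact_form X -> Omega X},
    (forall f : function_field X, D0 (exact_d f) = dform (der' f)) /\
    exists! D1 : Omega X -> Omega X,
      (forall w : exact_form X, D1 (exact_val w) = D0 w) /\
      is_delta_module der' D1.
Proof.
have lie_d := lie_dform hder' hext.
have lieM := lie_delta_module hder' hext.
split=> [f1 f2 e|]; first by rewrite -!lie_d e.
have lieB : zmod_morphism (fun w : exact_form X => lie der' (exact_val w)).
  move=> v w; apply: (canRL (addrK _)); rewrite -lieM.1.
  by rewrite -[_ + _]/(exact_val (v - w + w)) subrK.
pose D0 : {additive exact_form X -> Omega X} :=
  HB.pack (fun w : exact_form X => lie der' (exact_val w))
    (GRing.isZmodMorphism.Build _ _ _ lieB).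
exists D0; split=> [f|]; first exact: lie_d.
exists (lie der'); split=> [//|D1 [D1d D1M]].
by apply: (delta_module_unique lieM D1M) => f; rewrite (D1d (exact_d f)).
Qed.
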